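(* For $n\ge 1$, let $\mathbf{c}\in \mathrm{GF}(2)^n$, $d\in \mathrm{GF}(2)$, and let $p_l:\mathrm{GF}(2)^n\to\mathrm{GF}(2)$ be the line function in $n$ variables, $p_l(\mathbf{x})=\sum_{j=0}^{n-2}x_jx_{j+1}+\mathbf{c}\cdot\mathbf{x}+d$. Let $K_n^{IH}$ be the number of flat spectra of $p_l$ with respect to $\{I,H\}^n$, and set $K_0^{IH}=1$. Then $K_1^{IH}=1$, $K_n^{IH}=K_{n-1}^{IH}+K_{n-2}^{IH}$ for all $n\ge 2$, and in closed form $$K_n^{IH}=\frac{(1+\sqrt5)^{n+1}-(1-\sqrt5)^{n+1}}{2^{n+1}\sqrt5}\qquad(n\ge 0).$$
   Context: Let $I$ be the $2\times 2$ identity matrix, $H=\frac{1}{\sqrt2}\begin{pmatrix}1&1\\1&-1\end{pmatrix}$, and $N=\frac{1}{\sqrt2}\begin{pmatrix}1&i\\1&-i\end{pmatrix}$ with $i^2=-1$. For $S\subseteq\{I,H,N\}$, $S^n$ denotes the set of $|S|^n$ transforms $U=U_0\otimes U_1\otimes\cdots\otimes U_{n-1}$ with each $U_j\in S$ (the factor $U_j$ acts on the tensor position of variable $x_j$); each transform is identified with the choice $(U_0,\ldots,U_{n-1})$. For a Boolean function $p:\mathrm{GF}(2)^n\to\mathrm{GF}(2)$, let $(-1)^{p}\in\mathbb{C}^{2^n}$ be the vector with entries $(-1)^{p(\mathbf{x})}$ indexed by $\mathbf{x}=(x_0,\ldots,x_{n-1})\in\mathrm{GF}(2)^n$. The spectrum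 of $p$ with respect to $U$ is $P=U(-1)^p=(P_{\mathbf{k}})_{\mathbf{k}\in\mathrm{GF}(2)^n}$, and it is flat if $|P_{\mathbf{k}}|=1$ for all $\mathbf{k}$. The number of flat spectra of $p$ with respect to $S^n$ is the number of choices $(U_0,\ldots,U_{n-1})\in S^n$ for which the spectrum of $p$ is flat. *)

(* Defs.v *)
From HB Require Import structures.
From mathcomp Require Import all_boot all_order all_algebra finmap.
From mathcomp Require Import reals complex.

Set Implicit Arguments.
Unset Strict Implicit.
Unset Printing Implicit Defensive.

Import Order.TTheory GRing.Theory Num.Theory.
Local Open Scope ring_scope.
Local Open Scope complex_scope.

Section Spectra.
Variable R : realType.

Definition matI : 'M[R[i]]_2 := 1%:M.

Definition matH : 'M[R[i]]_2 :=
  ((Num.sqrt 2)^-1)%:C *: \matrix_(a, b) (if (a == 1) && (b == 1) then -1 else 1).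

Variable n : nat.

(* The tensor product U_0 (x) ... (x) U_(n-1), with rows and columns indexed
   by GF(2)^n instead of by ordinals. 'F_2 is convertible to the index type
   'I_2 of the 2 x 2 factors. *)
Definition tensor (U : 'I_n -> 'M[R[i]]_2) (k x : 'rV['F_2]_n) : R[i] :=
  \prod_(j < n) U j (k 0 j) (x 0 j).

Definition sign_vector (p : 'rV['F_2]_n -> 'F_2) (x : 'rV['F_2]_n) : R[i] :=
  (-1) ^+ (p x : nat).

Definition spectrum (U : 'I_n -> 'M[R[i]]_2) (p : 'rV['F_2]_n -> 'F_2)
    (k : 'rV['F_2]_n) : R[i] :=
  \sum_(x : 'rV['F_2]_n) tensor U k x * sign_vector p x.

Definition flat_spectrum (U : 'I_n -> 'M[R[i]]_2) (p : 'rV['F_2]_n -> 'F_2) : bool :=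
  [forall k, `|spectrum U p k| == 1].

(* Transforms in S^n are counted as choices (U_0, ..., U_(n-1)). *)
Definition num_flat (S : {fset 'M[R[i]]_2}) (p : 'rV['F_2]_n -> 'F_2) : nat :=
  #|[set U : {ffun 'I_n -> S} | flat_spectrum (fun j => val (U j)) p]|.

End Spectra.

(* The line function in n = m + 1 variables x_0, ..., x_m. *)
Definition line_fun (m : nat) (c : 'rV['F_2]_m.+1) (d : 'F_2)
    (x : 'rV['F_2]_m.+1) : 'F_2 :=
  \sum_(0 <= j < m) x 0 (inord j) * x 0 (inord j.+1)
  + \sum_(j < m.+1) c 0 j * x 0 j + d.

(* K_n^{IH}, where p_l in n variables has the coefficients c n and d n, which
   may be chosen independently for each n. *)
Definition K_IH (R : realType) (c : forall n, 'rV['F_2]_n) (d : nat -> 'F_2)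
    (n : nat) : nat :=
  if n is m.+1 then num_flat [fset matI R; matH R]%fset (line_fun (c m.+1) (d m.+1))
  else 1%N.

(* Main.v *)
(* Encode a transform as a word over {I, H}. Summing out the leading variables,
   an initial I substitutes x_0 = k_0 and an initial HH forces x_1 = k_0 + c_0;
   up to a sign, either leaves the spectrum of a shorter line with other linear
   coefficients. An initial HI, or H alone, makes some entry vanish. Hence the
   spectrum is flat iff all maximal runs of H have even length, and words with
   this property are counted by the Fibonacci recurrence. *)
Require Import Defs.
From HB Require Import structures.
From mathcomp Require Import all_boot all_order all_algebra finmap.
From mathcomp Require Import reals complex.
From mathcomp Require Import ring.

Import Order.TTheory GRing.Theory Num.Theory.
Local Open Scope ring_scope.

(** * Words with even runs of H, and the Fibonacci closed form *)

Lemma F2_cases (a : 'F_2) : a = 0 \/ a = 1.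
Proof. by case: a => [[|[|]]] // ?; [left | right]; apply: val_inj. Qed.

Lemma big_F2 (V : nmodType) (F : 'F_2 -> V) : \sum_a F a = F 0 + F 1.
Proof.
rewrite (big_ord_recl 1) big_ord_recl big_ord0 addr0.
by congr (F _ + F _); apply: val_inj.
Qed.

Lemma big_tuple_cons (T : finType) (V : nmodType) (n : nat)
    (F : n.+1.-tuple T -> V) :
  \sum_t F t = \sum_a \sum_(t : n.-tuple T) F [tuple of a :: t].
Proof.
rewrite pair_big /=.
rewrite (reindex (fun q : T * n.-tuple T => [tuple of q.1 :: q.2])) //=.
exists (fun t => (thead t, [tuple of behead t])) => [[a t] _ | t _] /=.
  by rewrite theadE; congr pair; apply: val_inj.
by rewrite -tuple_eta.
Qed.

(** The letter [true] stands for H and [false] for I. *)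
Fixpoint even_runs (w : seq bool) : bool :=
  match w with
  | [::] => true
  | false :: w' => even_runs w'
  | true :: true :: w' => even_runs w'
  | _ => false
  end.

Definition num_even_runs (n : nat) : nat :=
  (\sum_(w : n.-tuple bool) even_runs w)%N.

Lemma num_even_runs0 : num_even_runs 0 = 1%N.
Proof.
rewrite /num_even_runs (eq_bigr (fun=> 1%N)) => [|w _]; last by rewrite tuple0.
by rewrite sum1_card card_tuple.
Qed.

Lemma num_even_runs1 : num_even_runs 1 = 1%N.
Proof.
rewrite /num_even_runs (big_tuple_cons _ nat) big_bool /= -[RHS]num_even_runs0.
rewrite -[RHS]add0n; congr addn.
by apply: big1 => w _; rewrite tuple0.
Qed.

(** Split on the first letter: after I any good word of length [n.+1] may follow, while H must be
    followed by a second H and then a good word of length [n]. *)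
Lemma num_even_runsSS n :
  num_even_runs n.+2 = (num_even_runs n.+1 + num_even_runs n)%N.
Proof.
rewrite /num_even_runs (big_tuple_cons _ nat) big_bool /= addrC; congr addn.
rewrite (big_tuple_cons _ nat) big_bool /= -[RHS]addn0; congr addn.
exact: big1.
Qed.

Lemma fib_closed_form (R : rcfType) (f : nat -> nat) :
  f 0 = 1%N -> f 1 = 1%N -> (forall n, f n.+2 = f n.+1 + f n)%N ->
  forall n, (f n)%:R = ((1 + Num.sqrt 5) ^+ n.+1 - (1 - Num.sqrt 5) ^+ n.+1)
                       / (2 ^+ n.+1 * Num.sqrt 5) :> R.
Proof.
move=> f0 f1 fSS.
have s2 : Num.sqrt (5 : R) ^+ 2 = 5 by rewrite sqr_sqrtr ?ler0n.
have s0 : Num.sqrt (5 : R) != 0 by rewrite sqrtr_eq0 -ltNge ltr0n.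
move: (Num.sqrt _) s2 s0 => s s2 s0.
have t0 k : (2 : R) ^+ k != 0 by rewrite expf_neq0 ?pnatr_eq0.
move=> n; suff: (f n)%:R = ((1 + s) ^+ n.+1 - (1 - s) ^+ n.+1) / (2 ^+ n.+1 * s)
  /\ (f n.+1)%:R = ((1 + s) ^+ n.+2 - (1 - s) ^+ n.+2) / (2 ^+ n.+2 * s) by case.
elim: n => [|n [IH1 IH2]].
  rewrite f0 f1; split; first by field.
  by field.
split=> //; rewrite fSS natrD IH1 IH2.
(* If [z ^+ 2 = 5], then [1 + z] is a root of X^2 = 2X + 4, the Fibonacci equation scaled by 2. The
   factors 2 and 4 are absorbed by the powers of 2 in the denominators. *)
have root_rec (z : R) : z ^+ 2 = 5 ->
    (1 + z) ^+ n.+3 = 2 * (1 + z) ^+ n.+2 + 4 * (1 + z) ^+ n.+1.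
  move=> z2; rewrite !exprS.
  have -> : (1 + z) * ((1 + z) * ((1 + z) * (1 + z) ^+ n)) =
    (1 + 2 * z + z ^+ 2) * ((1 + z) * (1 + z) ^+ n) by ring.
  by rewrite z2; ring.
rewrite (root_rec s) // (root_rec (- s)) ?sqrrN //.
rewrite !(exprS 2); field.
by rewrite s0 t0.
Qed.

(** * Spectral entries computed letter by letter *)

Section Amplitude.
Variable R : realType.
Local Notation C := (R[i]).

Definition sgn (a : 'F_2) : C := (-1) ^+ (a : nat).

Lemma sgn0 : sgn 0 = 1. Proof. by []. Qed.
Lemma sgn1 : sgn 1 = -1. Proof. by []. Qed.

Lemma sgnD a b : sgn (a + b) = sgn a * sgn b.
Proof.
case: (F2_cases a) => ->; first by rewrite add0r sgn0 mul1r.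
case: (F2_cases b) => ->; first by rewrite addr0 sgn0 mulr1.
by rewrite sgn1 mulrNN mulr1.
Qed.

Lemma norm_sgn a : `|sgn a| = 1.
Proof. by rewrite normrX normrN1 expr1n. Qed.

Lemma sgn_sum (I : Type) (s : seq I) (F : I -> 'F_2) :
  sgn (\sum_(i <- s) F i) = \prod_(i <- s) sgn (F i).
Proof. exact: (big_morph sgn sgnD sgn0). Qed.

Definition mat_of (b : bool) : 'M[C]_2 := if b then matH R else matI R.

(** The entry at (0, 1) separates the matrices: it is nonzero in H and zero in I. This lets words
    stand for choices of transforms without collisions. *)
Lemma mat_of_inj : injective mat_of.
Proof.
have HI : matH R <> matI R.
  move/matrixP/(_ 0 1)/eqP; rewrite !mxE /= mulr1 mulr0n.
  by rewrite fmorph_eq0 invr_eq0 gt_eqF // sqrtr_gt0 ltr0n.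
by move=> [] [] //= E; case: HI.
Qed.

Lemma sum_matI (k : 'F_2) (F : 'F_2 -> C) :
  \sum_a mat_of false k a * F a = F k.
Proof.
rewrite (bigD1 k) //= mxE eqxx mul1r big1 ?addr0 // => a ak.
by rewrite mxE eq_sym (negbTE ak) mul0r.
Qed.

Local Notation r := (((Num.sqrt 2)^-1)%:C%C : C).

Lemma sqr_r : r * r = 2^-1.
Proof.
rewrite -rmorphM /= -invfM -expr2 sqr_sqrtr ?ler0n //.
by rewrite fmorphV rmorph_nat.
Qed.

Lemma sum_matH (k : 'F_2) (F : 'F_2 -> C) :
  \sum_a mat_of true k a * F a = r * (F 0 + sgn k * F 1).
Proof.
rewrite big_F2 /= !mxE /= andbF andbT mulr1 mulrDr; congr (_ + _).
rewrite -mulrA; congr (_ * (_ * _)).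
by case: (F2_cases k) => ->.
Qed.

(* The k-th spectral entry, with x_0, x_1, ... summed out one after the other;
   y is the value of the variable preceding the first letter of w. *)
Fixpoint amp (w : seq bool) (k c : nat -> 'F_2) (y : 'F_2) : C :=
  if w is b :: w' then
    \sum_a mat_of b (k 0%N) a *
      (sgn (a * (c 0%N + y)) * amp w' (k \o succn) (c \o succn) a)
  else 1.

Lemma amp_I w k c y :
  amp (false :: w) k c y =
    sgn (k 0%N * (c 0%N + y)) * amp w (k \o succn) (c \o succn) (k 0%N).
Proof. by rewrite /= sum_matI. Qed.

Lemma amp_H w k c y :
  amp (true :: w) k c y =
    r * (amp w (k \o succn) (c \o succn) 0
         + sgn (k 0%N + (c 0%N + y)) * amp w (k \o succn) (c \o succn) 1).
Proof. by rewrite /= sum_matH mul0r sgn0 !mul1r mulrA -sgnD. Qed.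

(* Summing out x_0 forces x_1 = k_0 + c_0 + y. *)
Lemma amp_HH w k c y :
  let e := k 0%N + (c 0%N + y) in
  amp [:: true, true & w] k c y =
    sgn (e * (k 1%N + c 1%N)) * amp w (k \o succn \o succn) (c \o succn \o succn) e.
Proof.
move=> e; rewrite !amp_H -/e /= addr0.
move: (amp w _ _) => A; rewrite addrA (sgnD (_ + _) 1) sgn1.
move: (k 1%N + c 1%N) (r) sqr_r => f q q2.
have two : (2 : C) != 0 by rewrite pnatr_eq0.
(* Summing over x_0 cancels the two terms with x_1 different from [e] and doubles the one with x_1 =
   [e]; the factor 2 is offset by the two normalizations, [q * q = 2^-1]. *)
case: (F2_cases e) => ->.
  rewrite mul0r sgn0.
  transitivity (q * q * 2 * A 0); first by ring.
  by rewrite q2 mulVf.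
rewrite mul1r sgn1.
transitivity (q * q * 2 * (sgn f * A 1)); first by ring.
by rewrite q2 mulVf // mul1r.
Qed.

(** Follows the recursion of [even_runs]; since HH removes two letters, the proof is by strong
    induction on length. The last two cases are the rejected endings of that recursion. *)
Lemma even_runs_ind (P : seq bool -> Prop) :
  P [::] -> (forall w, P w -> P (false :: w)) ->
  (forall w, P w -> P [:: true, true & w]) ->
  P [:: true] -> (forall w, P [:: true, false & w]) ->
  forall w, P w.
Proof.
move=> P0 PI PHH PH PHI w; have [m] := ubnP (size w).
elim: m w => // m IHm [|[] w] //= lt_w_m; last exact/PI/IHm.
case: w lt_w_m => [|[] w] //= lt_w_m.
exact/PHH/IHm/ltnW.
Qed.

Lemma norm_amp_even_runs w k c y : even_runs w -> `|amp w k c y| = 1.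
Proof.
elim/even_runs_ind: w k c y => // [|w IH|w IH] k c y; first by rewrite normr1.
  by rewrite amp_I normrM norm_sgn mul1r; apply: IH.
by rewrite amp_HH normrM norm_sgn mul1r; apply: IH.
Qed.

Lemma amp_not_even_runs w c y : ~~ even_runs w -> exists k, amp w k c y = 0.
Proof.
elim/even_runs_ind: w c y => // [w IH|w IH||w] c y.
- move=> /(IH (c \o succn) 0)[k ampk0].
  (* Taking k_0 = 0 makes x_0 = 0, so the tail starts with the preceding value 0 for which [k] was
     obtained. *)
  exists (fun j => if j is j'.+1 then k j' else 0).
  by rewrite amp_I ampk0 mulr0.
- move=> /(IH (c \o succn \o succn) 0)[k ampk0].
  (* This k_0 makes the forced value of x_1 equal to 0, matching the induction hypothesis; k_1 only
     affects a sign. *)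
  exists (fun j => match j with j'.+2 => k j' | 1%N => 0 | 0%N => - (c 0%N + y) end).
  by rewrite amp_HH addNr ampk0 mulr0.
- exists (fun=> 1 - (c 0%N + y)).
  by rewrite amp_H subrK sgn1 /= mulN1r subrr mulr0.
(* I at position 1 fixes x_1 = k_1 = 0, while k_0 is chosen to force x_1 = 1. *)
exists (fun j => if j is 0%N then 1 - (c 0%N + y) else 0 : 'F_2).
rewrite amp_H subrK !amp_I /= !mul0r sgn0 sgn1 !mul1r mulN1r.
by rewrite subrr mulr0.
Qed.

(** * From amplitudes to the spectra of the line function and their count *)

Lemma amp_sum (m : nat) (w : m.-tuple bool) k c y :
  amp w k c y =
    \sum_(t : m.-tuple 'F_2) \prod_(j < m)
      (mat_of (nth false w j) (k j) (nth 0 t j)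
       * sgn (nth 0 t j * (c j + nth 0 (y :: t) j))).
Proof.
elim: m w k c y => [|m IHm] w k c y.
  rewrite (tuple0 w) (eq_bigr (fun=> 1)) => [|t _]; last by rewrite big_ord0.
  by rewrite sumr_const card_tuple.
case/tupleP: w => b w; rewrite big_tuple_cons /=; apply: eq_bigr => a _.
rewrite IHm mulrA mulr_sumr; apply: eq_bigr => t _.
by rewrite big_ord_recl /=.
Qed.

(** Each edge of the line is charged to its right endpoint: [nth 0 (0 :: t) j] is the left neighbour
    of x_j, with a fictitious 0 before x_0. *)
Lemma line_fun_eq (m : nat) (c x : 'rV_m.+1) (d : 'F_2) :
  let t := [tuple x 0 j | j < m.+1] in
  line_fun c d x =
    d + \sum_(j < m.+1) nth 0 t j * (c 0 (inord j) + nth 0 (0 :: t) j).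
Proof.
move=> t; have tE j : (j < m.+1)%N -> nth 0 t j = x 0 (inord j).
  by move=> lt_jm; rewrite -(inordK lt_jm) -tnth_nth tnth_mktuple inord_val.
clearbody t; rewrite /line_fun addrC; congr (_ + _).
under [RHS]eq_bigr do rewrite mulrDr.
rewrite big_split [RHS]addrC /=; congr (_ + _).
  (* The term at x_0 vanishes by the prepended 0; shifting the index by one recovers the edges. *)
  rewrite big_ord_recl mulr0 add0r big_mkord; apply: eq_bigr => j _.
  by rewrite lift0 /= !tE ?ltnS // 1?mulrC // ltnW.
by apply: eq_bigr => j _; rewrite tE // inord_val mulrC.
Qed.

Lemma spectrum_line_fun (m : nat) (w : m.+1.-tuple bool) (c : 'rV_m.+1) (d : 'F_2)
    (k : nat -> 'F_2) :
  spectrum (fun j => mat_of (tnth w j)) (line_fun c d) (\row_j k j) =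
    sgn d * amp w k (fun j => c 0 (inord j)) 0.
Proof.
rewrite amp_sum mulr_sumr /spectrum.
rewrite (reindex (fun x : 'rV_m.+1 => [tuple x 0 j | j < m.+1])); last first.
  exists (fun t => \row_j tnth t j) => [x _|t _].
    by apply/rowP => j; rewrite mxE tnth_mktuple.
  by apply: eq_from_tnth => j; rewrite tnth_mktuple mxE.
apply: eq_bigr => x _.
rewrite /sign_vector -/(sgn _) line_fun_eq sgnD sgn_sum mulrCA; congr (_ * _).
rewrite /tensor -big_split; apply: eq_bigr => j _.
by rewrite mxE -!tnth_nth tnth_mktuple.
Qed.

Lemma flat_line_fun (m : nat) (w : m.+1.-tuple bool) (c : 'rV_m.+1) (d : 'F_2) :
  flat_spectrum (fun j => mat_of (tnth w j)) (line_fun c d) = even_runs w.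
Proof.
have [gw|ngw] := boolP (even_runs w).
  apply/forallP => k.
  have -> : k = \row_j (k 0 (inord j)) by apply/rowP => j; rewrite mxE inord_val.
  by rewrite (spectrum_line_fun _ w c d (fun j => k 0 (inord j))) normrM norm_sgn
    norm_amp_even_runs ?mul1r.
have [k ampk0] := amp_not_even_runs _ (fun j => c 0 (inord j)) 0 ngw.
apply/negbTE/negP => /forallP /(_ (\row_j k j)).
by rewrite spectrum_line_fun ampk0 mulr0 normr0 eq_sym oner_eq0.
Qed.

Lemma num_flat_line_fun (m : nat) (c : 'rV_m.+1) (d : 'F_2) :
  num_flat [fset matI R; matH R]%fset (line_fun c d) = num_even_runs m.+1.
Proof.
rewrite /num_flat /num_even_runs.
set S := [fset _; _]%fset.
have mat_in b : mat_of b \in S by rewrite !inE; case: b; rewrite eqxx ?orbT.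
(* Words correspond bijectively to choices of transforms; the inverse asks at each position whether
   the matrix is H. *)
pose phi (w : m.+1.-tuple bool) : {ffun 'I_m.+1 -> S} :=
  [ffun j => [` mat_in (tnth w j)]%fset].
have phi_bij : bijective phi.
  exists (fun U : {ffun 'I_m.+1 -> S} => [tuple val (U j) == matH R | j < m.+1]).
    move=> w; apply: eq_from_tnth => j; rewrite tnth_mktuple ffunE /=.
    by rewrite (inj_eq mat_of_inj (tnth w j) true) eqb_id.
  move=> U; apply/ffunP => j; apply: val_inj.
  rewrite ffunE /= tnth_mktuple.
  have /fset2P[->|->] := valP (U j); last by rewrite eqxx.
  by rewrite (inj_eq mat_of_inj false true).
rewrite -(on_card_preimset (onW_bij _ phi_bij)) -sum1_card big_mkcond /=.
apply: eq_bigr => w _; rewrite !inE -(flat_line_fun _ w c d) -mulrb natn.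
congr (nat_of_bool _); apply: eq_forallb => k; congr (`|_| == 1).
apply: eq_bigr => x _; congr (_ * _); apply: eq_bigr => j _.
by rewrite ffunE.
Qed.

End Amplitude.

Theorem lemma4 (R : realType) (c : forall n : nat, 'rV['F_2]_n) (d : nat -> 'F_2) :
  [/\ K_IH R c d 0 = 1%N,
      K_IH R c d 1 = 1%N,
      (forall n : nat, (2 <= n)%N ->
         K_IH R c d n = (K_IH R c d (n - 1) + K_IH R c d (n - 2))%N)
    & forall n : nat,
        (K_IH R c d n)%:R =
          ((1 + Num.sqrt 5) ^+ n.+1 - (1 - Num.sqrt 5) ^+ n.+1)
          / (2 ^+ n.+1 * Num.sqrt 5) :> R].
Proof.
have KE n : K_IH R c d n = num_even_runs n.
  by case: n => [|n]; rewrite ?num_even_runs0 //= num_flat_line_fun.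
split; rewrite ?KE ?num_even_runs0 ?num_even_runs1 //.
  by case=> [|[|n]] // _; rewrite !KE subn2 subn1 num_even_runsSS.
move=> n; rewrite KE; apply: fib_closed_form => {n} [||n].
- exact: num_even_runs0.
- exact: num_even_runs1.
- exact: num_even_runsSS.
Qed.
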